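(* Let $T>t_N$. Consider the data-driven differential inclusion $$\dot x(t)\in co\{\dot X_-(t),\dot X_+(t)\},\qquad x(t_N)=x_N,$$ with $u\equiv0$, where $\dot X_\pm(t)=F(t)\pm M\sigma(t)$, and the semi-algebraic unsafe set $$\mathcal{X}_u=\{x\in\mathbb{R}^n\mid l_i(x)\le0,\ i=1,\dots,n_c\},\qquad l_i\in\mathcal{R}[x].$$ Suppose there exist $B\in\mathcal{R}[x,t]$, $W_-\in\Sigma[x,t]$, $W_+\in\Sigma[x,t]$, $m_1,m_2\in\Sigma[x,t]$, $s_i\in\Sigma[x]$ ($i=1,\dots,n_c$) and a constant $c>0$ such that $$B(x,T)-B(x_N,t_N)+\sum_{i=1}^{n_c}s_i(x)\,l_i(x)-c\in\Sigma[x],$$ $$-\frac{\partial B}{\partial t}-\Big(\frac{\partial B}{\partial x}\Big)^T\dot X_--W_-(x,t)-m_1(x,t)(t-t_N)(T-t)\in\Sigma[x,t],$$ $$-\frac{\partial B}{\partial t}-\Big(\frac{\partial B}{\partial x}\Big)^T\dot X_+-W_+(x,t)-m_2(x,t)(t-t_N)(T-t)\in\Sigma[x,t].$$ Then every solution $x(\cdot)$ of the differential inclusion satisfies $x(T)\notin\mathcal{X}_u$.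
   Context: $co$ denotes the convex hull. $\mathcal{R}[x]$, $\mathcal{R}[x,t]$ are the real polynomials in the indicated variables ($x\in\mathbb{R}^n$, $t\in\mathbb{R}$). $\Sigma[\cdot]\subset\mathcal{R}[\cdot]$ is the subset of sums of squares of polynomials. Samples of state and input are available at times $t_1\le\cdots\le t_N$, and $x_N\in\mathbb{R}^n$ is the state at time $t_N$. A spline fit of the data gives the control-affine model $\dot X(t)=F(t)+G(t)u$ with $F(t)\in\mathbb{R}^n$, $G(t)\in\mathbb{R}^{n\times m}$ having (piecewise) polynomial entries in $t$. $M>0$ is a constant and $\sigma:\mathbb{R}_{\ge0}\to\mathbb{R}_{\ge0}$ satisfies $|\dot X(t)-\dot x(t)|\le M\sigma(t)$ (side information). In $F(t)\pm M\sigma(t)$ the scalar is added to (subtracted from) every component. Standing assumption: $\sigma\in\Sigma[t]$ and the vector fields of the inclusion are polynomial, i.e. on $[t_N,T]$ the components of $F$ (hence of $\dot X_\pm$) are polynomials in $t$; these polynomials are used in the sum-of-squares conditions. A solution on $[t_N,T]$ is an absolutely continuous function with values in $\mathbb{R}^n$ satisfying the inclusion for almost every $t$ and the initial condition. *)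

(* Defs.v *)
From HB Require Import structures.
From mathcomp Require Import all_boot all_order all_algebra.
(* multinomials has to be loaded before analysis: their notations clash in the
   other order. *)
From mathcomp Require Import mpoly.
From mathcomp Require Import all_classical all_reals all_analysis.

Set Implicit Arguments.
Unset Strict Implicit.
Unset Printing Implicit Defensive.

Import Order.TTheory GRing.Theory Num.Theory.
Import numFieldNormedType.Exports.
Local Open Scope classical_set_scope.
Local Open Scope ring_scope.

Definition sos (A : comNzRingType) (p : A) : Prop :=
  exists qs : seq A, p = \sum_(q <- qs) q ^+ 2.

(* The n + 1 values (x_1, ..., x_n, t): R[x, t] is {mpoly R[n + 1]}, whose last
   variable is t. *)
Definition joint (A : Type) (n : nat) (x : 'I_n -> A) (t : A) : 'I_(n + 1) -> A :=
  fun i => match fintype.split i with inl j => x j | inr _ => t end.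

Definition xvar (n : nat) (i : 'I_n) : 'I_(n + 1) := lshift 1 i.
Definition tvar (n : nat) : 'I_(n + 1) := rshift n ord0.

Section Polynomials.
Variables (R : comNzRingType) (n : nat).

Definition poly_in_t (p : {poly R}) : {mpoly R[n + 1]} :=
  horner_alg 'X_(tvar n) p.

Definition at_time (B : {mpoly R[n + 1]}) (T : R) : {mpoly R[n]} :=
  B \mPo mktuple (joint (fun i : 'I_n => 'X_i) T%:MP).

Definition lie_derivative (B : {mpoly R[n + 1]}) (f : 'I_n -> {poly R}) :
    {mpoly R[n + 1]} :=
  B^`M(tvar n) + \sum_(i < n) B^`M(xvar i) * poly_in_t (f i).

End Polynomials.

Definition convex_hull (R : numDomainType) (E : lmodType R) (A : set E) : set E :=
  smallest (@convex_set R E) A.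

Definition abs_continuous (R : realType) (V : normedModType R) (a b : R)
    (f : R -> V) : Prop :=
  forall e : R, 0 < e -> exists2 d : R, 0 < d &
    forall (k : nat) (u v : 'I_k -> R),
      (forall i, a <= u i /\ u i <= v i /\ v i <= b) ->
      trivIset [set: 'I_k] (fun i => `]u i, v i[%classic) ->
      \sum_(i < k) (v i - u i) < d ->
      \sum_(i < k) `|f (v i) - f (u i)| < e.

(* The derivative is two-sided; at the endpoints of [a, b] it involves values
   of x outside [a, b], but these two points are Lebesgue-null. *)
Definition inclusion_solution (R : realType) (V : normedModType R) (a b : R)
    (x0 : V) (K : R -> set V) (x : R -> V) : Prop :=
  [/\ abs_continuous a b x,
      {ae lebesgue_measure, forall t : R,
         a <= t <= b -> derivable x t 1 /\ K t (derive1 x t)}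
    & x a = x0].

(* r is added to every component of v. *)
Definition shift_by (R : nzRingType) (n : nat) (v : 'rV[R]_n) (r : R) : 'rV[R]_n :=
  v + const_mx r.

Definition semialg_set (R : realType) (n nc : nat) (l : 'I_nc -> {mpoly R[n]}) :
    set 'rV[R]_n :=
  [set x | forall i, (l i).@[x ord0] <= 0].

(* Main.v *)
Require Import Defs.
From HB Require Import structures.
From mathcomp Require Import all_boot all_order all_algebra.
From mathcomp Require Import mpoly.
From mathcomp Require Import ring lra.
From mathcomp Require Import all_classical all_reals all_analysis.
From mathcomp Require Import measurable_realfun.

Set Implicit Arguments.
Unset Strict Implicit.
Unset Printing Implicit Defensive.

Import Order.TTheory GRing.Theory Num.Theory.
Import numFieldNormedType.Exports.
Local Open Scope classical_set_scope.
Local Open Scope ring_scope.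

(** Along a solution x the number phi t = B(x(t), t) cannot increase, while the
    certificate at time T would force it to increase by at least c if x(T) were
    unsafe: there every l_i, hence sum_i s_i l_i, is nonpositive.

    At almost every t in [tN, T] the chain rule gives phi'(t) as the value at
    x'(t) of the affine function
      v |-> dB/dt + sum_i dB/dx_i * v_i,
    with the partial derivatives taken at (x(t), t). The two differential
    conditions make this function nonpositive at X_-(t) and at X_+(t): sums of
    squares take nonnegative values and (t - tN)(T - t) >= 0 on the interval.
    A half-space is convex, so the function is also nonpositive on their convex
    hull, which contains x'(t) ([convex_hull_halfspace]). Hence phi' <= 0 almost
    everywhere. Moreover phi is absolutely continuous, because absolutely
    continuous functions on a segment form an algebra
    ([abs_continuous_meval]).

    It remains to see that an absolutely continuous function whose derivative is
    almost everywhere nonpositive does not increase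
    ([abs_continuous_nonincreasing]). The proof avoids integration: the segment
    is divided into finitely many pieces, each lying either near a point of
    nonpositive derivative, where the growth is at most e times the length, or
    in an open set U of small measure around the exceptional points. The pieces
    of the second kind have small total length, so absolute continuity bounds
    the growth over them. *)

(** * Absolutely continuous functions with nonpositive derivative *)

(** A form of compactness of [a, b] (Cousin's lemma): a property that passes
    from u to v whenever u <= t <= v and both are close enough to t, where the
    admissible distance depends on t, passes from a to b. The supremum of the
    points with the property has it, and would be exceeded if it were not b. *)
Lemma interval_propagation (R : realType) (a b : R) (P : R -> Prop) :
  a <= b -> P a ->
  (forall t, a <= t <= b -> exists2 d : R, 0 < d & forall u v,
     a <= u -> v <= b -> t - d < u <= t -> t <= v < t + d -> P u -> P v) ->
  P b.
Proof.
move=> ab Pa step.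
pose S := [set t | a <= t <= b /\ P t].
have Sa : S a by split => //; rewrite lexx ab.
have Sb : ubound S b by move=> t [/andP[]].
have supS : has_sup S by split; [exists a | exists b].
have a_sup : a <= sup S by apply: ub_le_sup => //; exists b.
have sb : sup S <= b by apply: ge_sup => //; exists a.
have [d d0 stepd] := step (sup S) (introT andP (conj a_sup sb)).
have [u [/andP[au ub] Pu] du] := sup_adherent d0 supS.
have us : u <= sup S by apply: ub_le_sup; [exists b | split=> //; rewrite au ub].
have [bd|db] := ltP b (sup S + d).
  by apply: (stepd u) => //; rewrite ?sb ?du ?us.
have Pv : P (sup S + d / 2).
  by apply: (stepd u) => //; [lra | rewrite du us | lra].
have : sup S + d / 2 <= sup S.
  apply: ub_le_sup; first by exists b.
  by split => //; lra.
by lra.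
Qed.

(** The two points lie on opposite sides of [t]; the estimate fails in general
    for two points on the same side, as only the slopes of chords through [t]
    are controlled. *)
Lemma nonpos_derive_straddle (R : realType) (f : R -> R) (t l e : R) :
  is_derive t 1 f l -> l <= 0 -> 0 < e ->
  exists2 d : R, 0 < d & forall u v,
    t - d < u <= t -> t <= v < t + d -> f v - f u <= e * (v - u).
Proof.
move=> [df <-] l0 e0.
have /cvgrPdist_lt /(_ e e0) [d /= d0 near_d] := df.
exists d => // u v /andP[du ut] /andP[tv vd].
have quo h : `|h| < d -> h != 0 -> h^-1 * (f (h + t) - f t) < e.
  move=> hd h0.
  have := near_d h; rewrite /ball_ /= sub0r normrN => /(_ hd h0).
  rewrite /GRing.scale /= mulr1 ltr_norml => /andP[+ _].
  rewrite /derive /= in l0 *; lra.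
have fv : f v - f t <= e * (v - t).
  have [->|vt] := eqVneq v t; first by rewrite !subrr mulr0.
  have vt0 : 0 < v - t by rewrite subr_gt0 lt_neqAle eq_sym vt.
  have := quo (v - t); rewrite gtr0_norm // gt_eqF // => /(_ _ isT).
  rewrite subrK mulrC ltr_pdivrMr // => h; apply/ltW/h; lra.
have fu : f t - f u <= e * (t - u).
  have [->|ut'] := eqVneq u t; first by rewrite !subrr mulr0.
  have ut0 : u - t < 0 by rewrite subr_lt0 lt_neqAle ut'.
  have := quo (u - t); rewrite ltr0_norm // lt_eqF // => /(_ _ isT).
  rewrite subrK mulrC ltr_ndivrMr // => h.
  have : e * (u - t) < f u - f t by apply: h; lra.
  lra.
lra.
Qed.

(** The exceptional points, where nothing is known about the growth of [f], lie
    in [U]. The list [s] collects the pieces of a subdivision of [a, b] that are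
    tagged by points of [U], the most recent (rightmost) one first; each of the
    others contributes at most [e] times its length to the growth of [f]. *)
Lemma cover_by_straddle (R : realType) (f : R -> R) (a b e : R) (U : set R) :
  a <= b -> open U ->
  (forall t, a <= t <= b -> ~ U t ->
    exists2 d : R, 0 < d & forall u v,
      t - d < u <= t -> t <= v < t + d -> f v - f u <= e * (v - u)) ->
  0 < e ->
  exists s : seq (R * R),
    [/\ all (fun p => [&& a <= p.1, p.1 <= p.2 & p.2 <= b]) s,
        pairwise (fun p q => q.2 <= p.1) s,
        forall p, p \in s -> `]p.1, p.2[ `<=` U &
        f b - f a <= e * (b - a) + \sum_(p <- s) `|f p.2 - f p.1|].
Proof.
move=> ab oU straddle e0.
pose P t := exists s : seq (R * R),
    [/\ all (fun p => [&& a <= p.1, p.1 <= p.2 & p.2 <= t]) s,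
        pairwise (fun p q => q.2 <= p.1) s,
        forall p, p \in s -> `]p.1, p.2[ `<=` U &
        f t - f a <= e * (t - a) + \sum_(p <- s) `|f p.2 - f p.1|].
apply: (@interval_propagation _ a b P) => //.
  by exists [::]; split => //; rewrite big_nil !subrr mulr0 addr0.
move=> t tab.
have [Ut|nUt] := pselect (U t).
  have /nbhs_ballP[d /= d0 dU] : nbhs t U by apply: open_nbhs_nbhs.
  exists d => // u v au vb /andP[du ut] /andP[tv vd] [s [sab sd sU sf]].
  exists ((u, v) :: s); split => /=.
  - rewrite au lexx andbT (le_trans ut tv) /=.
    by apply: sub_all sab => p /and3P[-> -> /= pu]; lra.
  - by rewrite sd andbT; apply: sub_all sab => p /and3P[].
  - move=> p; rewrite inE => /orP[/eqP ->|/sU//] r /=.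
    rewrite in_itv /= => /andP[ur rv]; apply: dU.
    by rewrite /ball /= ltr_norml; lra.
  - rewrite big_cons /=.
    have := ler_norm (f v - f u).
    have : 0 <= e * (v - u) by apply: mulr_ge0; lra.
    lra.
have [d d0 fd] := straddle t tab nUt.
exists d => // u v au vb du dv [s [sab sd sU sf]].
exists s; split => //.
  by apply: sub_all sab => p /and3P[-> -> /= pu]; lra.
have := fd u v du dv; lra.
Qed.

(** The rightmost interval comes first in [s], so that the others lie in the part
    of [U] to its left; this is the set to which the induction applies. *)
Lemma total_length_le (R : realType) (U : set R) (s : seq (R * R)) :
  open U -> all (fun p => p.1 <= p.2) s -> pairwise (fun p q => q.2 <= p.1) s ->
  (forall p, p \in s -> `]p.1, p.2[ `<=` U) ->
  ((\sum_(p <- s) (p.2 - p.1))%:E <= lebesgue_measure U)%E.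
Proof.
elim: s U => [|p s IH] U oU /=; first by rewrite big_nil.
move=> /andP[p12 s12] /andP[ps sd] sU; rewrite big_cons EFinD.
have -> : (p.2 - p.1)%:E = lebesgue_measure `]p.1, p.2[%classic :> \bar R.
  rewrite lebesgue_measure_itv /= lte_fin EFinB.
  by case: ltgtP p12 => // -> _; rewrite subee.
have oUp : open (U `&` `]-oo, p.1[%classic) by apply: openI => //; exact: interval_open.
apply: (@le_trans _ _ (lebesgue_measure (`]p.1, p.2[%classic : set R) +
    lebesgue_measure (U `&` `]-oo, p.1[%classic))%E).
  apply: leeD => //; apply: IH => // q qs r rq; split.
    by apply: (sU q) => //; rewrite inE qs orbT.
  move/allP/(_ q qs) : ps; move: rq; rewrite /= !in_itv /=; lra.
rewrite -measureU //.
- apply: le_measure; rewrite ?inE.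
  + by apply: measurableU; [exact: measurable_itv | exact: open_measurable].
  + exact: open_measurable.
  + by move=> r [rp|[]//]; apply: (sU p) => //; rewrite inE eqxx.
- exact: open_measurable.
- apply/seteqP; split => // r [] /=; rewrite !in_itv /= => + [_].
  lra.
Qed.

(** Differentiability almost everywhere alone is not enough (Cantor's function);
    absolute continuity controls the growth over the pieces that cover the
    exceptional null set. *)
Lemma abs_continuous_nonincreasing (R : realType) (a b : R) (f : R -> R) :
  a <= b -> abs_continuous a b f ->
  {ae lebesgue_measure, forall t : R, a <= t <= b ->
     exists2 l : R, is_derive t 1 f l & l <= 0} ->
  f b <= f a.
Proof.
move=> ab acf [E [mE E0 subE]].
suff H e : 0 < e -> f b - f a <= e * (b - a) + e.
  rewrite -subr_le0; apply/ler_addgt0Pr => e e0.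
  have ba1 : 0 < b - a + 1 by lra.
  (* The parameter e' is chosen so that e' (b - a) + e' = e. *)
  have := H (e / (b - a + 1)) (divr_gt0 e0 ba1).
  have -> : e / (b - a + 1) * (b - a) + e / (b - a + 1) = e.
    by field; rewrite gt_eqF.
  by rewrite add0r.
move=> e0; have [d d0 acd] := acf e e0.
(* The null set of exceptional points sits in an open set of measure below the
   threshold d at which absolute continuity bounds the variation by e. *)
have [|U [oU EU]] := @lebesgue_regularity_outer R E d mE _ d0.
  by rewrite [X in (X < _)%E]E0.
move=> UE.
have muU : (lebesgue_measure U < d%:E)%E.
  apply: le_lt_trans UE.
  rewrite -{1}(setDKU EU) measureU //.
  - by rewrite [X in (_ + X <= _)%E]E0 adde0.
  - by apply: measurableD => //; exact: open_measurable.
  - by rewrite setDKI.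
have [|s [sab sd sU sf]] := @cover_by_straddle R f a b e U ab oU _ e0.
  move=> t tab nUt.
  have [l dl l0] : exists2 l : R, is_derive t 1 f l & l <= 0.
    by apply: contrapT => nl; apply: nUt; apply: EU; apply: subE => /(_ tab).
  exact: (nonpos_derive_straddle dl).
apply: (le_trans sf); rewrite lerD2l.
pose T := in_tuple s.
rewrite big_tnth; apply/ltW/(acd _ (fun i => (tnth T i).1) (fun i => (tnth T i).2)).
- by move=> i; move/allP : sab => /(_ _ (mem_tnth i T)) /and3P[].
- apply/trivIsetP => i j _ _.
  wlog ij : i j / (i < j)%N.
    move=> W; have [ij|ji|/val_inj ->] := ltngtP i j; last by rewrite eqxx.
      exact: W.
    by rewrite eq_sym setIC; exact: W.
  move=> _; apply/seteqP; split => // r [] /=; rewrite !in_itv /=.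
  have := pairwiseP (tnth T i) sd i j (ltn_ord i) (ltn_ord j) ij.
  rewrite -!(tnth_nth (tnth T i) T); lra.
- rewrite -(big_tnth _ _ _ xpredT (fun p : R * R => p.2 - p.1)) -lte_fin.
  apply: le_lt_trans muU; apply: total_length_le => //.
  by apply: sub_all sab => p /and3P[].
Qed.

(** * Polynomials along differentiable and absolutely continuous curves *)

Lemma mpoly_ring_ind (R : nzRingType) (n : nat) (P : {mpoly R[n]} -> Prop) :
  (forall c, P c%:MP) -> (forall i, P 'X_i) ->
  (forall p q, P p -> P q -> P (p + q)) ->
  (forall p q, P p -> P q -> P (p * q)) -> forall p, P p.
Proof.
move=> PC PX PD PM.
have PXm m : P 'X_[m].
  rewrite mpolyXE_id; apply: (big_ind P) => //; first exact: (PC 1).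
  move=> i _; elim: (m i) => [|k IH]; first exact: (PC 1).
  by rewrite exprS; exact: PM.
elim/mpolyind => [|c m p _ _ Pp]; first exact: (PC 0).
by rewrite -mul_mpolyC; apply: PD => //; apply: PM.
Qed.

Lemma is_derive_meval (R : realType) (N : nat) (v : R -> 'I_N -> R)
    (dv : 'I_N -> R) (t : R) (p : {mpoly R[N]}) :
  (forall i, is_derive t 1 (v^~ i) (dv i)) ->
  is_derive t 1 (fun r => p.@[v r]) (\sum_i p^`M(i).@[v t] * dv i).
Proof.
move=> dvt; elim/mpoly_ring_ind: p => [c|i|p q IHp IHq|p q IHp IHq].
- under eq_fun do rewrite mevalC.
  rewrite big1 => [|i _]; first exact: is_derive_cst.
  by rewrite mderivC meval0 mul0r.
- under eq_fun do rewrite mevalXU.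
  rewrite (bigD1 i) //= big1 ?addr0 => [|j ji].
    by rewrite mderivX mnmE eqxx -{1}[U_(i)%MM]add0m addmK mpolyX0 scale1r meval1 mul1r.
  by rewrite mderivX mnmE eq_sym (negbTE ji) scale0r meval0 mul0r.
- under eq_fun do rewrite mevalD.
  under eq_bigr do rewrite mderivD mevalD mulrDl.
  by rewrite big_split; exact: is_deriveD.
- under eq_fun do rewrite mevalM.
  have := is_deriveM IHp IHq.
  congr (is_derive _ _ _ _).
  rewrite /GRing.scale /= !mulr_sumr -big_split /=; apply: eq_bigr => i _.
  by rewrite mderivM mevalD !mevalM; ring.
Qed.

Section AbsContinuous.
Variables (R : realType) (a b : R).
Implicit Types f g : R -> R.

Lemma abs_continuous_cst (c : R) : abs_continuous a b (fun=> c).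
Proof.
move=> e e0; exists 1 => // k u v _ _ _.
by rewrite big1 // => i _; rewrite subrr normr0.
Qed.

Lemma abs_continuous_id : abs_continuous a b (fun t : R => t).
Proof.
move=> e e0; exists e => // k u v uv _.
congr (_ < _); apply: eq_bigr => i _; rewrite ger0_norm // subr_ge0.
by have [_ []] := uv i.
Qed.

(** The common reason why sums and products of absolutely continuous functions
    are absolutely continuous. *)
Lemma abs_continuous_dominated (C : R) f g (h : R -> R) :
  0 <= C -> abs_continuous a b f -> abs_continuous a b g ->
  (forall u v, a <= u -> u <= v -> v <= b ->
     `|h v - h u| <= C * (`|f v - f u| + `|g v - g u|)) ->
  abs_continuous a b h.
Proof.
move=> C0 acf acg fgh e e0.
have C1 : 0 < 2 * C + 1 by lra.
(* Each of the two sums below is less than e / (2 C + 1), so that C times their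
   total is less than e, even if C = 0. *)
have e'0 : 0 < e / (2 * C + 1) by exact: divr_gt0.
have [d1 d10 acd1] := acf _ e'0.
have [d2 d20 acd2] := acg _ e'0.
exists (Num.min d1 d2); first by rewrite lt_min d10 d20.
move=> k u v uv triv; rewrite lt_min => /andP[/(acd1 _ _ _ uv triv) sf].
move=> /(acd2 _ _ _ uv triv) sg.
apply: (@le_lt_trans _ _ (C * (\sum_(i < k) `|f (v i) - f (u i)| +
    \sum_(i < k) `|g (v i) - g (u i)|))).
  rewrite -big_split mulr_sumr; apply: ler_sum => i _.
  by have [? []] := uv i; exact: fgh.
apply: (@le_lt_trans _ _ (C * (2 * (e / (2 * C + 1))))).
  by apply: ler_wpM2l => //; lra.
rewrite !mulrA ltr_pdivrMr //; lra.
Qed.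

Lemma abs_continuousD f g : abs_continuous a b f -> abs_continuous a b g ->
  abs_continuous a b (fun t => f t + g t).
Proof.
move=> acf acg; apply: (@abs_continuous_dominated 1 f g) => // u v _ _ _.
by rewrite mul1r opprD addrACA ler_normD.
Qed.

(** Over a subinterval shorter than the [d] associated with [e = 1] the function
    varies by less than 1, so boundedness propagates from [a] to [b]. *)
Lemma abs_continuous_bounded f : a <= b -> abs_continuous a b f ->
  exists2 C : R, 0 <= C & forall t, a <= t <= b -> `|f t| <= C.
Proof.
move=> ab acf; have [d d0 osc] := acf 1 ltr01.
have near_f u v : a <= u -> u <= v -> v <= b -> v - u < d -> `|f v - f u| < 1.
  move=> au uv vb vud.
  have := osc 1 (fun=> u) (fun=> v); rewrite !big_ord1; apply => //.
  by apply/trivIsetP => i j _ _; rewrite !ord1 eqxx.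
pose P t := exists2 C : R, 0 <= C & forall r, a <= r <= t -> `|f r| <= C.
apply: (@interval_propagation _ a b P) => //.
  by exists `|f a| => // r ra; rewrite (_ : r = a) //; apply/le_anti; lra.
move=> t _; exists (d / 2); first exact: divr_gt0.
move=> u v au vb du dv [C C0 fC]; exists (C + 1) => [|r /andP[ar rv]]; first lra.
have [ru|ur] := leP r u.
  by apply: (le_trans (fC r _)); [rewrite ar ru | lra].
have fru : `|f r - f u| < 1 by apply: near_f; lra.
have := ler_normD (f r - f u) (f u); rewrite subrK.
have : `|f u| <= C by apply: fC; rewrite au lexx.
lra.
Qed.

Lemma abs_continuousM f g : a <= b ->
  abs_continuous a b f -> abs_continuous a b g ->
  abs_continuous a b (fun t => f t * g t).
Proof.
move=> ab acf acg.
have [Cf Cf0 fC] := abs_continuous_bounded ab acf.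
have [Cg Cg0 gC] := abs_continuous_bounded ab acg.
apply: (@abs_continuous_dominated (Cf + Cg) f g) => // [|u v au uv vb].
  exact: addr_ge0.
have -> : f v * g v - f u * g u = f v * (g v - g u) + (f v - f u) * g u by ring.
apply: (le_trans (ler_normD _ _)); rewrite !normrM.
have fv : `|f v| <= Cf by apply: fC; lra.
have gu : `|g u| <= Cg by apply: gC; lra.
have := ler_wpM2r (normr_ge0 (g v - g u)) fv.
have := ler_wpM2l (normr_ge0 (f v - f u)) gu.
have := mulr_ge0 Cf0 (normr_ge0 (f v - f u)).
have := mulr_ge0 Cg0 (normr_ge0 (g v - g u)).
lra.
Qed.

Lemma abs_continuous_meval (N : nat) (v : R -> 'I_N -> R) (p : {mpoly R[N]}) :
  a <= b -> (forall i, abs_continuous a b (v^~ i)) ->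
  abs_continuous a b (fun t => p.@[v t]).
Proof.
move=> ab acv; elim/mpoly_ring_ind: p => [c|i|p q IHp IHq|p q IHp IHq].
- under eq_fun do rewrite mevalC; exact: abs_continuous_cst.
- under eq_fun do rewrite mevalXU; exact: acv.
- under eq_fun do rewrite mevalD; exact: (abs_continuousD IHp IHq).
- under eq_fun do rewrite mevalM; exact: (abs_continuousM ab IHp IHq).
Qed.

Lemma abs_continuous_coord (n : nat) (x : R -> 'rV[R]_n) (i : 'I_n) :
  abs_continuous a b x -> abs_continuous a b (fun t => x t ord0 i).
Proof.
move=> acx e e0; have [d d0 acd] := acx e e0.
exists d => // k u v uv triv lt_d; apply: le_lt_trans (acd k u v uv triv lt_d).
apply: ler_sum => j _; rewrite [leRHS]/Num.Def.normr /= mx_normrE.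
have := le_bigmax 0 (fun ij => `|(x (v j) - x (u j)) ij.1 ij.2|) (ord0, i).
by rewrite /= !mxE.
Qed.

End AbsContinuous.

(** * Pointwise values of the certificate *)

Lemma meval_sos_ge0 (R : realDomainType) (N : nat) (p : {mpoly R[N]})
    (v : 'I_N -> R) : sos p -> 0 <= p.@[v].
Proof.
move=> [qs ->]; rewrite rmorph_sum sumr_ge0 // => q _.
by rewrite rmorphXn sqr_ge0.
Qed.

Lemma joint_xvar (A : Type) (n : nat) (x : 'I_n -> A) (t : A) (i : 'I_n) :
  joint x t (xvar i) = x i.
Proof. by rewrite /joint (unsplitK (inl i)). Qed.

Lemma joint_tvar (A : Type) (n : nat) (x : 'I_n -> A) (t : A) :
  joint x t (tvar n) = t.
Proof. by rewrite /joint (unsplitK (inr ord0)). Qed.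

Lemma meval_poly_in_t (R : comNzRingType) (n : nat) (p : {poly R})
    (v : 'I_n -> R) (t : R) : (poly_in_t n p).@[joint v t] = p.[t].
Proof.
rewrite /poly_in_t; elim/poly_ind: p => [|p c IH].
  by rewrite rmorph0 meval0 horner0.
rewrite rmorphD rmorphM /= horner_algX horner_algC mevalD mevalM IH hornerMXaddC.
by rewrite mevalXU -mul_mpolyC mulr1 mevalC joint_tvar.
Qed.

Lemma meval_lie_derivative (R : comNzRingType) (n : nat) (B : {mpoly R[n + 1]})
    (f : 'I_n -> {poly R}) (v : 'I_n -> R) (t : R) :
  (lie_derivative B f).@[joint v t] =
  B^`M(tvar n).@[joint v t] +
    \sum_(i < n) B^`M(xvar i).@[joint v t] * (f i).[t].
Proof.
rewrite /lie_derivative mevalD; congr (_ + _); rewrite rmorph_sum.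
by apply: eq_bigr => i _; rewrite rmorphM /= meval_poly_in_t.
Qed.

Lemma meval_at_time (R : comNzRingType) (n : nat) (B : {mpoly R[n + 1]})
    (v : 'I_n -> R) (t : R) : (at_time B t).@[v] = B.@[joint v t].
Proof.
rewrite /at_time comp_mpoly_meval; apply: meval_eq => i.
rewrite tnth_mktuple /joint; case: fintype.split => j.
  exact: mevalXU.
exact: mevalC.
Qed.

(** A half-space containing [A] is a convex set containing [A], hence contains
    the smallest one. *)
Lemma convex_hull_halfspace (R : numDomainType) (n : nat) (A : set 'rV[R]_n)
    (p : 'I_n -> R) (r : R) (w : 'rV[R]_n) :
  (forall v, A v -> r + \sum_(i < n) p i * v ord0 i <= 0) ->
  convex_hull A w -> r + \sum_(i < n) p i * w ord0 i <= 0.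
Proof.
move=> Ar; apply: (smallest_sub (X := [set v : 'rV[R]_n |
  r + \sum_(i < n) p i * v ord0 i <= 0])) => // y z k.
rewrite !inE /= => yr zr.
have -> : r + \sum_(i < n) p i * (conv k y z) ord0 i =
    k%:num * (r + \sum_(i < n) p i * y ord0 i) +
    (1 - k%:num) * (r + \sum_(i < n) p i * z ord0 i).
  rewrite !mulrDr addrACA -mulrDl subrKC mul1r; congr (_ + _).
  rewrite !mulr_sumr -big_split; apply: eq_bigr => i _.
  by rewrite /conv /= !mxE /unstable.onem; ring.
have k0 : 0 <= k%:num :> R by [].
have k1 : 0 <= 1 - k%:num :> R by rewrite subr_ge0.
by rewrite -oppr_ge0 opprD addr_ge0 // -mulrN mulr_ge0 // oppr_ge0.
Qed.

(** * The barrier certificate along a trajectory *)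

Lemma meval_trajectory_derive (R : realType) (n : nat) (B : {mpoly R[n + 1]})
    (x : R -> 'rV[R]_n) (t : R) : derivable x t 1 ->
  is_derive t 1 (fun r => B.@[joint (x r ord0) r])
    (B^`M(tvar n).@[joint (x t ord0) t] +
     \sum_(i < n) B^`M(xvar i).@[joint (x t ord0) t] * derive1 x t ord0 i).
Proof.
move=> dx.
have := @is_derive_meval R (n + 1) (fun r => joint (x r ord0) r)
  (joint (derive1 x t ord0) 1) t B.
rewrite big_split_ord big_ord1 /= joint_tvar mulr1 addrC.
under eq_bigr do rewrite joint_xvar.
apply => i; rewrite /joint; case: fintype.split => j.
  rewrite derive1E derive_mx // mxE; apply: DeriveDef => //.
  exact: (derivable_mxP _ _ _).1 dx ord0 j.
exact: is_derive_id.
Qed.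

Theorem lemma1 (R : realType) (n nc : nat)
    (tN T M : R) (xN : 'rV[R]_n)
    (F : R -> 'rV[R]_n) (Fp : 'I_n -> {poly R}) (sigma : {poly R})
    (l : 'I_nc -> {mpoly R[n]})
    (B Wm Wp m1 m2 : {mpoly R[n + 1]}) (s : 'I_nc -> {mpoly R[n]}) (c : R) :
  tN < T -> 0 < M -> sos sigma ->
  (forall t : R, tN <= t <= T -> forall i, F t ord0 i = (Fp i).[t]) ->
  let Xm := fun t : R => shift_by (F t) (- (M * sigma.[t])) in
  let Xp := fun t : R => shift_by (F t) (M * sigma.[t]) in
  let Xm_poly := fun i => Fp i - M *: sigma in
  let Xp_poly := fun i => Fp i + M *: sigma in
  let time_dom : {mpoly R[n + 1]} :=
    ('X_(tvar n) - tN%:MP) * (T%:MP - 'X_(tvar n)) in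
  sos Wm -> sos Wp -> sos m1 -> sos m2 -> (forall i, sos (s i)) -> 0 < c ->
  sos (at_time B T - (B.@[joint (xN ord0) tN])%:MP
       + \sum_(i < nc) s i * l i - c%:MP) ->
  sos (- lie_derivative B Xm_poly - Wm - m1 * time_dom) ->
  sos (- lie_derivative B Xp_poly - Wp - m2 * time_dom) ->
  forall x : R -> 'rV[R]_n,
    inclusion_solution tN T xN (fun t => convex_hull [set Xm t; Xp t]) x ->
    ~ semialg_set l (x T).
Proof.
move=> ltT M0 sos_sigma FE Xm Xp Xm_poly Xp_poly time_dom.
move=> sosWm sosWp sosm1 sosm2 soss c0 sosT sosm sosp x [acx aex x0] unsafe.
pose phi t := B.@[joint (x t ord0) t].
have decr : phi T <= phi tN.
  apply: abs_continuous_nonincreasing; first exact: ltW.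
    apply: abs_continuous_meval; first exact: ltW.
    move=> i; rewrite /joint; case: fintype.split => j.
      exact: abs_continuous_coord.
    exact: abs_continuous_id.
  apply: (negligibleS _ aex); apply: subsetC => t + tNT => /(_ tNT) [dx Kx].
  eexists; first exact: meval_trajectory_derive.
  apply: convex_hull_halfspace Kx => v.
  have lie_le0 f W m : sos W -> sos m ->
      sos (- lie_derivative B f - W - m * time_dom) ->
      (lie_derivative B f).@[joint (x t ord0) t] <= 0.
    move=> /(meval_sos_ge0 (joint (x t ord0) t)) W0.
    move=> /(meval_sos_ge0 (joint (x t ord0) t)) m0.
    move=> /(meval_sos_ge0 (joint (x t ord0) t)).
    rewrite !mevalB mevalN !mevalM !mevalB !mevalC !mevalXU joint_tvar.
    have := mulr_ge0 m0 (mulr_ge0 _ _ : 0 <= (t - tN) * (T - t)).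
    lra.
  have := (lie_le0 _ _ _ sosWm sosm1 sosm).
  have := (lie_le0 _ _ _ sosWp sosm2 sosp).
  rewrite !meval_lie_derivative => lep lem [->|->];
    [apply: le_trans lem | apply: le_trans lep]; rewrite lerD2l;
    apply: ler_sum => i _; rewrite !mxE FE // hornerE ?hornerN hornerZ.
  - by [].
  - by [].
have := meval_sos_ge0 (x T ord0) sosT.
rewrite mevalB mevalD mevalB meval_at_time !mevalC rmorph_sum /=.
have : \sum_(i < nc) (s i * l i).@[x T ord0] <= 0.
  apply: sumr_le0 => i _; rewrite mevalM mulr_ge0_le0 //.
  exact: meval_sos_ge0.
move: decr; rewrite /phi x0; lra.
Qed.
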